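(* Let $\mathfrak m$ be a multisegment. For every standard order $(\Delta_1,\ldots,\Delta_k)$ of $\mathfrak m$, the order $(\Delta_1,\ldots,\Delta_k)$ admits a relevant decomposition if and only if the reversed dual order $(\Delta_k^\vee,\ldots,\Delta_1^\vee)$ of $\mathfrak m^\vee$ admits a relevant decomposition. Consequently, $\mathfrak m$ is distinguished if and only if $\mathfrak m^\vee$ is distinguished, and the following two assertions are equivalent: (i) every distinguished multisegment $\mathfrak m$ is of Speh type; (ii) every multisegment $\mathfrak m$ such that both $\mathfrak m$ and $\mathfrak m^\vee$ are distinguished is of Speh type.
   Context: A segment is a set $[a,b]=\{a,a+1,\ldots,b\}$ of consecutive integers, $a\le b$; write $\mathbf b([a,b])=a$ (beginning), $\mathbf e([a,b])=b$ (endpoint), and $\mathrm{Sgm}$ for the set of segments. Put $\nu[a,b]=[a+1,b+1]$ and $[a,b]^\vee=[-b,-a]$. A multisegment is a finitely supported function $\mathfrak m:\mathrm{Sgm}\to\mathbb Z_{\ge0}$ (a finite multiset of segments); sums and $\le$ are pointwise; $(\nu^n\mathfrak m)(\Delta)=\mathfrak m(\nu^{-n}\Delta)$ and $\mathfrak m^\vee(\Delta)=\mathfrak m(\Delta^\vee)$. An order of $\mathfrak m$ is a listing $(\Delta_1,\ldots,\Delta_k)$ in which each segment $\Delta$ occurs exactly $\mathfrak m(\Delta)$ times. Write $[a,b]\prec[a',b']$ if $a<a'$, $b<b'$ and $b\ge a'-1$. An order $(\Delta_1,\ldots,\Delta_k)$ is standard if $\Delta_i\not\prec\Delta_j$ whenever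 $i<j$. A decomposition of a segment $\Delta$ is a tuple of segments $(\Delta_1,\ldots,\Delta_r)$, $r\ge1$, with $\mathbf e(\Delta_1)=\mathbf e(\Delta)$, $\mathbf b(\Delta_r)=\mathbf b(\Delta)$ and $\mathbf e(\Delta_{i+1})=\mathbf b(\Delta_i)-1$ for $1\le i\le r-1$. A decomposition of an order $(\Delta_1,\ldots,\Delta_k)$ is a choice of a decomposition $(\Delta_{i,1},\ldots,\Delta_{i,k_i})$ of each $\Delta_i$; its index set is $I=\{(i,j):1\le i\le k,\ 1\le j\le k_i\}$, ordered lexicographically ($\prec_{\mathrm{lex}}$), and $(i,j)\ll(i',j')$ means $i<i'$. The decomposition is relevant to the order if there is an involution $\tau:I\to I$ with: (R1) $\tau(i,j+1)\ll\tau(i,j)$ for all $1\le i\le k$, $1\le j\le k_i-1$; (R2) $\tau(\imath)\ne\imath$ for all $\imath\in I$; (R3) $\Delta_\imath=\nu\Delta_{\tau(\imath)}$ whenever $\imath\prec_{\mathrm{lex}}\tau(\imath)$. An order admits a relevant decomposition if some decomposition of it is relevant to it. $\mathfrak m$ is distinguished if every standard order of $\mathfrak m$ admits a relevant decomposition. $\mathfrak m$ is of Speh type if $\mathfrak m=\mathfrak n+\nu\mathfrak n$ for some multisegment $\mathfrak n$. *)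

(* Defs.v *)
From HB Require Import structures.
From mathcomp Require Import all_boot all_order all_algebra.
From mathcomp Require Import finmap multiset.

Set Implicit Arguments.
Unset Strict Implicit.
Unset Printing Implicit Defensive.

Import Order.TTheory GRing.Theory Num.Theory.

Local Open Scope ring_scope.
Local Open Scope mset_scope.

(* The segment {a, a+1, ..., b} is encoded by its pair of extremities. *)
Record sgm := Sgm { sgm_val : int * int; _ : sgm_val.1 <= sgm_val.2 }.

HB.instance Definition _ := [isSub for sgm_val].
HB.instance Definition _ := [Choice of sgm by <:].

Definition sbeg (D : sgm) : int := (sgm_val D).1.
Definition send (D : sgm) : int := (sgm_val D).2.

Fact sshift_subproof (n : int) (D : sgm) : sbeg D + n <= send D + n.
Proof. by rewrite lerD2r; case: D. Qed.

(* The n-th power of nu; nu itself is sshift 1. *)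
Definition sshift (n : int) (D : sgm) : sgm :=
  @Sgm (sbeg D + n, send D + n) (sshift_subproof n D).

Fact sdual_subproof (D : sgm) : - send D <= - sbeg D.
Proof. by rewrite lerN2; case: D. Qed.

Definition sdual (D : sgm) : sgm :=
  @Sgm (- send D, - sbeg D) (sdual_subproof D).

Lemma sshiftK (n : int) : cancel (sshift n) (sshift (- n)).
Proof. by case=> -[a b] h; apply/val_inj; rewrite /= /sbeg /send /= !addrK. Qed.

Lemma sdualK : involutive sdual.
Proof. by case=> -[a b] h; apply/val_inj; rewrite /= /sbeg /send /= !opprK. Qed.

(* {mset sgm} is the type of finitely supported functions sgm -> nat, with *)
(* pointwise sum `+`.                                                      *)
Definition mseg : Type := {mset sgm}.

Definition mshift (n : int) (m : mseg) : mseg :=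
  [fsfun D in [fset sshift n D' | D' in finsupp m]%fset
     => m (sshift (- n) D) | 0%N].

Definition mdual (m : mseg) : mseg :=
  [fsfun D in [fset sdual D' | D' in finsupp m]%fset => m (sdual D) | 0%N].

Lemma mshiftE (n : int) (m : mseg) (D : sgm) :
  mshift n m D = m (sshift (- n) D).
Proof.
rewrite fsfunE; case: ifPn => // /imfsetP nD; apply/esym/fsfun_dflt/negP => mD.
by apply: nD; exists (sshift (- n) D); rewrite // -[LHS](sshiftK (- n)) opprK.
Qed.

Lemma mdualE (m : mseg) (D : sgm) : mdual m D = m (sdual D).
Proof.
rewrite fsfunE; case: ifPn => // /imfsetP nD; apply/esym/fsfun_dflt/negP => mD.
by apply: nD; exists (sdual D); rewrite // sdualK.
Qed.

Definition is_order (m : mseg) (s : seq sgm) : Prop :=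
  forall D : sgm, count_mem D s = m D.

Definition sprec (D D' : sgm) : bool :=
  [&& sbeg D < sbeg D', send D < send D' & sbeg D' - 1 <= send D].

Definition standard (s : seq sgm) : bool :=
  pairwise (fun D D' => ~~ sprec D D') s.

Definition sgm_decomp (D : sgm) (ds : seq sgm) : bool :=
  if ds is D1 :: ds' then
    [&& send D1 == send D, sbeg (last D1 ds') == sbeg D
      & path (fun x y => send y == sbeg x - 1) D1 ds']
  else false.

Definition order_decomp (s : seq sgm) (dss : seq (seq sgm)) : bool :=
  all2 sgm_decomp s dss.

Section Relevant.

Variable dss : seq (seq sgm).

(* Indices are numbered from 0. *)
Definition dindex : finType :=
  {i : 'I_(size dss) & 'I_(size (tnth (in_tuple dss) i))}.

Definition drow (x : dindex) : nat := tag x.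
Definition dcol (x : dindex) : nat := tagged x.

Definition dsgm (x : dindex) : sgm :=
  tnth (in_tuple (tnth (in_tuple dss) (tag x))) (tagged x).

Definition dll (x y : dindex) : bool := (drow x < drow y)%N.

Definition dlex (x y : dindex) : bool :=
  (drow x < drow y)%N || (drow x == drow y) && (dcol x < dcol y)%N.

Definition relevant : Prop :=
  exists tau : dindex -> dindex,
    [/\ involutive tau,
        forall x y : dindex, drow y = drow x -> dcol y = (dcol x).+1 ->
          dll (tau y) (tau x),
        forall x : dindex, tau x <> x
      & forall x : dindex, dlex x (tau x) ->
          dsgm x = sshift 1 (dsgm (tau x))].

End Relevant.

Definition admits_relevant (s : seq sgm) : Prop :=
  exists dss : seq (seq sgm), order_decomp s dss /\ relevant dss.

Definition distinguished (m : mseg) : Prop :=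
  forall s : seq sgm, is_order m s -> standard s -> admits_relevant s.

Definition speh_type (m : mseg) : Prop :=
  exists n : mseg, m = n `+` mshift 1 n.

Definition order_dual (s : seq sgm) : seq sgm := rev [seq sdual D | D <- s].

Lemma is_order_dual (m : mseg) (s : seq sgm) :
  is_order m s -> is_order (mdual m) (order_dual s).
Proof.
move=> ms D; rewrite mdualE -ms count_rev count_map; apply: eq_count => D' /=.
by rewrite (can2_eq sdualK sdualK).
Qed.

(* Main.v *)
Require Import Defs.
From mathcomp Require Import all_boot.
From mathcomp Require Import all_order all_algebra finmap.
From mathcomp Require Import zify.

(** Relevance of a decomposition is invariant under mirroring: dualize every
    segment and reverse both the list of rows and each row.  On indices this
    is the bijection (i, j) |-> (k - 1 - i, k_i - 1 - j), where row i has
    length k_i and numbering starts at 0; a matching tau is conjugated by it.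

    The conditions on tau survive because each reversal is met by another
    one.  Condition (R1) says that the row of the
    partner drops when the column grows; mirroring reverses both the columns
    and the rows.  Condition (R2) is invariant under conjugation.  For (R3),
    the mirror reverses the lexicographic order, so x precedes tau x in the
    mirror exactly when tau x precedes x in the original; there
    Delta_(tau x) = nu Delta_x, and dualizing, which turns nu into its inverse,
    gives Delta_x^v = nu Delta_(tau x)^v.

    So admitting a relevant decomposition passes to the reversed dual order
    (lemma admits_relevant_dual), and back because the operation is an
    involution.  The same mirror exchanges the standard orders of m and of its
    dual, because dualizing reverses the relation of precedence between segments
    (lemmas is_order_dual and standard_dual).  Hence m is distinguished exactly
    when its dual is, and the extra hypothesis on the dual in the second Speh type
    assertion is automatic. *)

Set Implicit Arguments.
Unset Strict Implicit.
Unset Printing Implicit Defensive.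

Import Order.TTheory GRing.Theory Num.Theory.

Local Open Scope ring_scope.

Lemma sprec_dual (D D' : sgm) : sprec (sdual D) (sdual D') = sprec D' D.
Proof.
rewrite /sprec /sdual /sbeg /send /= !ltrN2 andbCA.
by rewrite -opprD lerN2 lerBlDr.
Qed.

Lemma sdual_shift (D D' : sgm) : D = sshift 1 D' -> sdual D' = sshift 1 (sdual D).
Proof.
move=> ->; apply/val_inj; rewrite /= /sbeg /send /=.
by rewrite !opprD !addrNK.
Qed.

Lemma order_dualK : involutive order_dual.
Proof.
move=> s; rewrite /order_dual map_rev revK -map_comp.
by rewrite (eq_map (g := id)) ?map_id // => D /=; rewrite sdualK.
Qed.

Lemma mdualK : involutive mdual.
Proof. by move=> m; apply/fsfunP => D; rewrite !mdualE sdualK. Qed.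

Lemma standard_dual (s : seq sgm) : standard (order_dual s) = standard s.
Proof.
rewrite /standard /order_dual; elim: s => //= D s IHs.
rewrite rev_cons pairwise_rcons IHs all_rev all_map; congr (_ && _).
by apply: eq_all => D' /=; rewrite sprec_dual.
Qed.

Lemma sgm_decomp_dual (D : sgm) (ds : seq sgm) :
  sgm_decomp D ds -> sgm_decomp (sdual D) (order_dual ds).
Proof.
case: ds => [//|D1 ds] /and3P[eD bD pD].
rewrite /order_dual -map_rev lastI rev_rcons /=; apply/and3P; split.
- by rewrite /send /= -/(sbeg _) (eqP bD).
- rewrite last_map; have -> : last (last D1 ds) (rev (belast D1 ds)) = D1.
    by case: {eD bD pD} ds => //= D2 ds; rewrite rev_cons last_rcons.
  by rewrite /sbeg /= -/(send _) (eqP eD).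
- rewrite path_map rev_path; apply: sub_path pD => x y /= /eqP exy.
  by rewrite -[_ == _]/(- sbeg x == - send y - 1) exy opprB addrC addKr.
Qed.

Definition mirror (dss : seq (seq sgm)) : seq (seq sgm) :=
  rev [seq order_dual ds | ds <- dss].

Lemma mirrorK : involutive mirror.
Proof.
move=> dss; rewrite /mirror map_rev revK -map_comp.
by rewrite (eq_map (g := id)) ?map_id // => ds /=; rewrite order_dualK.
Qed.

Lemma order_decomp_mirror (s : seq sgm) (dss : seq (seq sgm)) :
  order_decomp s dss -> order_decomp (order_dual s) (mirror dss).
Proof.
rewrite /order_decomp /order_dual /mirror !all2E !size_rev !size_map.
case/andP=> /eqP sz dec; rewrite sz eqxx /= -rev_zip ?size_map // all_rev.
elim: s dss sz dec => [|D s IHs] [|ds dss] //= [sz] /andP[dD dec].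
by rewrite sgm_decomp_dual //= IHs.
Qed.

Lemma size_mirror (dss : seq (seq sgm)) : size (mirror dss) = size dss.
Proof. by rewrite size_rev size_map. Qed.

Lemma nth_mirror (dss : seq (seq sgm)) (i : nat) : (i < size dss)%N ->
  nth [::] (mirror dss) (size dss - i.+1) = order_dual (nth [::] dss i).
Proof.
move=> lt_i; rewrite nth_rev size_map; last by lia.
by rewrite (nth_map [::]); [congr (order_dual (nth _ _ _))|]; lia.
Qed.

Section Indices.

Variable dss : seq (seq sgm).

Definition row_of (x : dindex dss) : seq sgm := nth [::] dss (drow x).

Lemma row_ofE (x : dindex dss) : tnth (in_tuple dss) (tag x) = row_of x.
Proof. exact: tnth_nth. Qed.

Lemma drow_lt (x : dindex dss) : (drow x < size dss)%N.
Proof. exact: ltn_ord. Qed.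

Lemma dcol_lt (x : dindex dss) : (dcol x < size (row_of x))%N.
Proof. by rewrite -row_ofE; apply: ltn_ord (tagged x). Qed.

Lemma dsgmE (D : sgm) (x : dindex dss) : dsgm x = nth D (row_of x) (dcol x).
Proof. by rewrite /dsgm (tnth_nth D) -[RHS]/(nth D _ (tagged x)) -row_ofE. Qed.

Lemma dindex_inj (x y : dindex dss) : drow x = drow y -> dcol x = dcol y -> x = y.
Proof.
case: x y => [i j] [i' j'] /val_inj /= ei; move: j'; rewrite -ei => j' ej.
by congr existT; apply: val_inj.
Qed.

Lemma dindex_exists (i j : nat) :
  (i < size dss)%N -> (j < size (nth [::] dss i))%N ->
  {x : dindex dss | drow x = i & dcol x = j}.
Proof.
move=> lt_i; rewrite -[nth _ _ _](tnth_nth [::] (in_tuple dss) (Ordinal lt_i)).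
by move=> lt_j; exists (existT _ (Ordinal lt_i) (Ordinal lt_j)).
Qed.

End Indices.

(** The second decomposition is a variable constrained by an equation so that
    the inverse, which goes from the mirror back, is an instance of the
    same construction, without casts along the involutivity of the mirror. *)
Lemma mirror_index_exists (dss dss' : seq (seq sgm)) (x : dindex dss) :
  dss' = mirror dss ->
  {x' : dindex dss' | drow x' = (size dss - (drow x).+1)%N
                    & dcol x' = (size (row_of x) - (dcol x).+1)%N}.
Proof.
move=> ->; have ltr := drow_lt x; have ltc := dcol_lt x.
apply: dindex_exists; first by rewrite size_mirror; lia.
by rewrite nth_mirror // size_rev size_map; move: ltc; rewrite /row_of; lia.
Qed.

Section MirrorIndex.

Variables (dss dss' : seq (seq sgm)) (E : dss' = mirror dss).

Definition mirror_index (x : dindex dss) : dindex dss' :=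
  s2val (mirror_index_exists x E).

Lemma drow_mirror (x : dindex dss) :
  drow (mirror_index x) = (size dss - (drow x).+1)%N.
Proof. by rewrite /mirror_index; case: mirror_index_exists. Qed.

Lemma dcol_mirror (x : dindex dss) :
  dcol (mirror_index x) = (size (row_of x) - (dcol x).+1)%N.
Proof. by rewrite /mirror_index; case: mirror_index_exists. Qed.

Lemma row_of_mirror (x : dindex dss) :
  row_of (mirror_index x) = order_dual (row_of x).
Proof. by rewrite /row_of drow_mirror E nth_mirror ?drow_lt. Qed.

Lemma dsgm_mirror (x : dindex dss) : dsgm (mirror_index x) = sdual (dsgm x).
Proof.
have ltc := dcol_lt x.
rewrite (dsgmE (sdual (dsgm x))) row_of_mirror dcol_mirror.
rewrite nth_rev size_map; last by lia.
rewrite (nth_map (dsgm x)); last by lia.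
by rewrite [in RHS](dsgmE (dsgm x)); congr (sdual (nth _ _ _)); lia.
Qed.

Lemma dll_mirror (x y : dindex dss) :
  dll (mirror_index x) (mirror_index y) = dll y x.
Proof.
have := drow_lt x; have := drow_lt y.
by rewrite /dll !drow_mirror; lia.
Qed.

Lemma dlex_mirror (x y : dindex dss) :
  dlex (mirror_index x) (mirror_index y) = dlex y x.
Proof.
have rx := drow_lt x; have ry := drow_lt y.
rewrite /dlex !drow_mirror !dcol_mirror.
have [exy|/eqP nxy] := eqVneq (drow x) (drow y); last by lia.
have := dcol_lt x; have := dcol_lt y; rewrite /row_of exy; lia.
Qed.

End MirrorIndex.

Lemma mirror_indexK (dss dss' : seq (seq sgm))
    (E : dss' = mirror dss) (E' : dss = mirror dss') :
  cancel (mirror_index E) (mirror_index E').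
Proof.
move=> x; have ltr := drow_lt x; have ltc := dcol_lt x.
apply: dindex_inj; first by rewrite !drow_mirror E size_mirror; lia.
by rewrite !dcol_mirror row_of_mirror size_rev size_map; lia.
Qed.

(** The matching of the mirror is the conjugate of the given one by the
    mirror bijection of indices. *)
Lemma relevant_mirror (dss : seq (seq sgm)) :
  relevant dss -> relevant (mirror dss).
Proof.
case=> tau [tauK R1 R2 R3].
have E : mirror dss = mirror dss by [].
have E' : dss = mirror (mirror dss) by rewrite mirrorK.
pose f := mirror_index E; pose g := mirror_index E'.
have fK : cancel f g by apply: mirror_indexK.
have gK : cancel g f by apply: mirror_indexK.
exists (f \o tau \o g); split=> [x|x y exy cxy|x /=|x /=].
- by rewrite /= fK tauK gK.
(* Consecutive columns come back swapped, and so do the rows of partners. *)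
- rewrite /= dll_mirror; apply: R1; first by rewrite !drow_mirror exy.
  have := dcol_lt y; rewrite !dcol_mirror cxy /row_of exy; lia.
- by move/(congr1 g); rewrite fK => /R2.
- rewrite -[x]gK; move: (g x) => y; rewrite fK dlex_mirror => lex_y.
  rewrite !dsgm_mirror; apply: sdual_shift.
  by rewrite -[in RHS](tauK y); apply: R3; rewrite tauK.
Qed.

Lemma admits_relevant_dual (s : seq sgm) :
  admits_relevant s -> admits_relevant (order_dual s).
Proof.
case=> dss [dec rel]; exists (mirror dss).
by split; [apply: order_decomp_mirror | apply: relevant_mirror].
Qed.

Lemma distinguished_dual (m : mseg) : distinguished m -> distinguished (mdual m).
Proof.
move=> dm s os ss; rewrite -[s]order_dualK; apply: admits_relevant_dual.
by apply: dm; [rewrite -[m]mdualK; apply: is_order_dual | rewrite standard_dual].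
Qed.

Theorem theorem1p3 :
  (forall m : mseg,
     (forall s : seq sgm, is_order m s -> standard s ->
        (admits_relevant s <-> admits_relevant (order_dual s))) /\
     (distinguished m <-> distinguished (mdual m))) /\
  ((forall m : mseg, distinguished m -> speh_type m) <->
   (forall m : mseg, distinguished m -> distinguished (mdual m) ->
      speh_type m)).
Proof.
split=> [m|]; last first.
  by split=> H m dm => [_|]; apply: H => //; apply: distinguished_dual.
split=> [s _ _|]; split=> H; try exact: admits_relevant_dual.
- by rewrite -[s]order_dualK; apply: admits_relevant_dual.
- exact: distinguished_dual.
- by rewrite -[m]mdualK; apply: distinguished_dual.
Qed.
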